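(* Let $t$ be any time slot and let $\mathbf{h}(t)\in\mathbb{C}^{N_r\times 1}$ be a random channel at time $t$. The channel at time $t+1$ can be represented by the channel at time $t$ as follows: $$\widetilde{\mathbf{h}}(t+1)=\mathbf{A}(t)\,\widetilde{\mathbf{h}}(t)+\boldsymbol{\xi}(t+1),$$ where the state transition matrix $\mathbf{A}(t)$ is defined as $$\mathbf{A}(t)=\mathbf{C}_{\mathbf{h}}(t+1,t)\,\mathbf{C}_{\mathbf{h}}^{-1}(t),$$ and the autoregressive noise $\boldsymbol{\xi}(t+1)$ is distributed as $\mathcal{CN}(\mathbf{0},\boldsymbol{\Theta}(t+1))$ with $$\boldsymbol{\Theta}(t+1)=\mathbf{C}_{\mathbf{h}}(t+1)-\mathbf{C}_{\mathbf{h}}(t+1,t)\,\mathbf{C}_{\mathbf{h}}^{-1}(t)\,\mathbf{C}_{\mathbf{h}}(t,t+1).$$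
   Context: The channel between a single-antenna user and a base station with $N_r$ antennas is a (generally non-stationary) complex random process $\mathbf{h}(t)\in\mathbb{C}^{N_r\times 1}$, $t\in\mathbb{N}^+$. $\overline{\mathbf{h}}(t)=\mathbb{E}[\mathbf{h}(t)]$ is the mean, $\widetilde{\mathbf{h}}(t)=\mathbf{h}(t)-\overline{\mathbf{h}}(t)$ the centered channel, $\mathbf{C}_{\mathbf{h}}(t)=\mathbb{E}[\widetilde{\mathbf{h}}(t)\widetilde{\mathbf{h}}(t)^{H}]$ the autocovariance (taken to be invertible), and $\mathbf{C}_{\mathbf{h}}(t_1,t_2)=\mathbb{E}[\widetilde{\mathbf{h}}(t_1)\widetilde{\mathbf{h}}(t_2)^{H}]$ the cross-covariance; all these may change with time. The two terms $\mathbf{A}(t)\widetilde{\mathbf{h}}(t)$ (correlation information) and $\boldsymbol{\xi}(t+1)$ (innovative information) are independent of each other. $^{H}$ is the conjugate transpose and $\mathcal{CN}(\mathbf{0},\boldsymbol{\Theta})$ the complex Gaussian law with mean $\mathbf{0}$ and covariance $\boldsymbol{\Theta}$.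
   Formalization: The noise's law CN(0,Θ(t+1)) is claimed only when (h(t),h(t+1)) is jointly circularly-symmetric complex Gaussian, as it fails for i.i.d. non-Gaussian channels; for every square-integrable channel the representation, zero mean and covariance Θ(t+1) of the noise are claimed. *)

(* Defs.v *)
From HB Require Import structures.
From mathcomp Require Import all_boot all_order all_algebra.
From mathcomp Require Import complex.
From mathcomp Require Import all_classical all_reals all_analysis.
Set Implicit Arguments.
Unset Strict Implicit.
Unset Printing Implicit Defensive.
Import Order.TTheory GRing.Theory Num.Theory.

Local Open Scope classical_set_scope.
Local Open Scope ring_scope.
Local Open Scope complex_scope.

Definition adjmx (R : realType) (m n : nat) (M : 'M[R[i]]_(m, n)) :
  'M[R[i]]_(n, m) := (map_mx (@conjc R) M)^T.

Notation "M ^H" := (adjmx M) (at level 8, format "M ^H") : ring_scope.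

(* Borel sets of C^n, identified with R^(2n) through real and imaginary parts:
   the sigma-algebra generated by the 2n real coordinate maps. *)
Definition borel_cvec (R : realType) (n : nat) : set (set 'cV[R[i]]_n) :=
  <<s [set U | exists (i : 'I_n) (B : set R), measurable B /\
        (U = [set x : 'cV[R[i]]_n | B (complex.Re (x i 0))] \/
         U = [set x : 'cV[R[i]]_n | B (complex.Im (x i 0))])] >>.

(* Normal law on R parametrized by its variance; v = 0 is the Dirac mass, which
   normal_prob does not cover (normal_prob m 0 is not a point mass). *)
Definition normal_var (R : realType) (m v : R) : set R -> \bar R :=
  if v == 0 then \d_m else normal_prob m (Num.sqrt v).

Section RandomVectors.
Context (d : measure_display) (Omega : measurableType d) (R : realType).
Variable P : probability Omega R.

Definition random_cvec (n : nat) (X : Omega -> 'cV[R[i]]_n) : Prop :=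
  forall U, borel_cvec U -> measurable (X @^-1` U).

(* Membership in Lfun includes measurability. *)
Definition square_integrable (n : nat) (X : Omega -> 'cV[R[i]]_n) : Prop :=
  forall i, (fun w => complex.Re (X w i 0)) \in Lfun P 2%:E /\
            (fun w => complex.Im (X w i 0)) \in Lfun P 2%:E.

Definition cexpect (Z : Omega -> R[i]) : R[i] :=
  fine 'E_P[fun w => complex.Re (Z w)] +i* fine 'E_P[fun w => complex.Im (Z w)].

Definition mxexpect (m n : nat) (Z : Omega -> 'M[R[i]]_(m, n)) :
  'M[R[i]]_(m, n) := \matrix_(i, j) cexpect (fun w => Z w i j).

Definition centered (n : nat) (X : Omega -> 'cV[R[i]]_n) (w : Omega) :
  'cV[R[i]]_n := X w - mxexpect X.

Definition crosscov (m n : nat) (X : Omega -> 'cV[R[i]]_m)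
    (Y : Omega -> 'cV[R[i]]_n) : 'M[R[i]]_(m, n) :=
  mxexpect (fun w => centered X w *m (centered Y w)^H).

(* Circularly-symmetric complex Gaussian law CN(mu, Theta), Theta possibly
   singular. With c = a + i b, Re (c^H X) = a^T Re X + b^T Im X, so the last
   clause says that every real linear functional of (Re X, Im X) is normal, with
   the mean and variance given by the real covariance matrix
   1/2 [[Re Theta, - Im Theta], [Im Theta, Re Theta]].
   In the order of R[i], 0 <= z means that z is real and nonnegative, so the
   second clause says that Theta is Hermitian positive semidefinite. *)
Definition complex_normal (n : nat) (X : Omega -> 'cV[R[i]]_n)
    (mu : 'cV[R[i]]_n) (Theta : 'M[R[i]]_n) : Prop :=
  [/\ random_cvec X,
      forall c : 'cV[R[i]]_n, 0 <= (c^H *m Theta *m c) 0 0 &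
      forall (c : 'cV[R[i]]_n) (B : set R), measurable B ->
        P [set w | B (complex.Re ((c^H *m X w) 0 0))] =
        normal_var (complex.Re ((c^H *m mu) 0 0))
                   (complex.Re ((c^H *m Theta *m c) 0 0) / 2) B].

(* The stacked vector (X, Y) is complex Gaussian; its parameters are then
   necessarily its own mean and covariance. *)
Definition jointly_complex_normal (m n : nat) (X : Omega -> 'cV[R[i]]_m)
    (Y : Omega -> 'cV[R[i]]_n) : Prop :=
  let Z := fun w => col_mx (X w) (Y w) in
  complex_normal Z (mxexpect Z) (crosscov Z Z).

Definition independent_cvec (m n : nat) (X : Omega -> 'cV[R[i]]_m)
    (Y : Omega -> 'cV[R[i]]_n) : Prop :=
  forall U V, borel_cvec U -> borel_cvec V ->
    P (X @^-1` U `&` Y @^-1` V) = (P (X @^-1` U) * P (Y @^-1` V))%E.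

End RandomVectors.

(* Main.v *)
(* Set xi = h~(t+1) - A h~(t); the moment identities are then bilinear algebra.
   If (h(t), h(t+1)) is Gaussian, A h~(t) and xi are images K Z, J Z of one
   centered Gaussian vector Z with covariance G, and K G J^H = 0.  Since
   E cos(L + a) = cos a exp(-v/2) for L of law N(0, v), the cosines of real
   linear functionals of K Z and of J Z factorize in expectation.  Factorization
   passes to bounded pointwise limits of linear combinations of such cosines.
   The product-to-sum formula makes the class of these limits an algebra, and it
   contains the indicators of half-spaces: 1_{x >= 0} is the limit of
   1_{sin(x/m) >= 0}, which is itself a limit of polynomials in sin(x/m).  Hence
   it contains the indicators of all Borel sets, which gives independence without
   the uniqueness theorem for characteristic functions. *)
Require Import Defs.
From HB Require Import structures.
From mathcomp Require Import all_boot all_order all_algebra.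
From mathcomp Require Import complex ring lra measurable_realfun.
From mathcomp Require Import all_classical all_reals all_analysis.
Import Order.TTheory GRing.Theory Num.Theory.
Import numFieldNormedType.Exports.
Local Open Scope classical_set_scope.
Local Open Scope ring_scope.
Local Open Scope complex_scope.
Set Implicit Arguments.
Unset Strict Implicit.

(** * Fourier transform of the normal law *)

(** The fundamental theorem of calculus on growing symmetric intervals leaves only boundary values,
    and dominated convergence, with [|f|] as the bound, passes to the whole line. This serves as
    integration by parts with vanishing boundary terms. *)
Lemma integral_derivative_eq0 (R : realType) (F f : R -> R) :
  (forall x : R, is_derive x 1 F (f x)) -> continuous f ->
  lebesgue_measure.-integrable setT (fun x => (f x)%:E) ->
  F n%:R @[n --> \oo] --> 0 -> F (- n%:R) @[n --> \oo] --> 0 ->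
  (\int[lebesgue_measure]_x (f x)%:E = 0)%E.
Proof.
move=> dF cf intf Fy FNy.
(* The index [n.+1] makes every interval nondegenerate, as the fundamental theorem requires. *)
pose I n : set R := `[- n.+1%:R, n.+1%:R]%classic.
have mf : measurable_fun setT (EFin \o f).
  by apply/measurable_EFinP; exact: continuous_measurable_fun.
have int_cvg : (\int[lebesgue_measure]_x ((EFin \o f) \_ (I n) x) @[n --> \oo] -->
    \int[lebesgue_measure]_x (f x)%:E)%E.
  apply: (@dominated_cvg _ _ R lebesgue_measure setT measurableT
    (fun n => (EFin \o f) \_ (I n)) (EFin \o f) (fun x => `|(f x)%:E|%E)) => //.
  - move=> n; apply/(measurable_restrictT _ _).1; first exact: measurable_itv.
    exact: measurable_funS mf.
  - move=> x _; apply: cvg_near_cst; near=> n.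
    rewrite patchE mem_set// /I /= in_itv/= -ler_norml.
    rewrite ltW// (lt_le_trans (truncnS_gt _))// ler_nat ltnS.
    by near: n; exists (Num.trunc `|x|).
  - exact: integrable_abse.
  - by move=> n x _; rewrite patchE; case: ifPn => //; rewrite abse0 abse_ge0.
have FTC n : (\int[lebesgue_measure]_x ((EFin \o f) \_ (I n) x) =
    (F n.+1%:R - F (- n.+1%:R))%:E)%E.
  rewrite -integral_mkcond EFinB; apply: continuous_FTC2.
  - by rewrite -subr_gt0 opprK -natrD ltr0n.
  - exact: continuous_subspaceT.
  - have cF : continuous F.
      by move=> x; apply: differentiable_continuous; exact/derivable1_diffP.
    split; first by move=> x _; exact: ex_derive.
    + by apply: cvg_at_right_filter; exact: cF.
    + by apply: cvg_at_left_filter; exact: cF.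
  - by move=> x _; rewrite derive1E; exact: derive_val.
have int_cvg0 : ((F n.+1%:R - F (- n.+1%:R))%:E @[n --> \oo] --> (0%R)%:E)%E.
  apply: cvg_EFin; first by near=> n.
  rewrite -[0]subr0; apply: cvgB; first by rewrite (cvg_shiftS (fun n => F n%:R)).
  by rewrite (cvg_shiftS (fun n => F (- n%:R))).
move: int_cvg; rewrite (eq_cvg _ _ FTC) => int_cvg.
exact: cvg_unique int_cvg int_cvg0.
Unshelve. all: by end_near. Qed.

Section NormalDensity.
Context {R : realType} (sigma : R) (sigma_neq0 : sigma != 0).
Local Notation mu := (@lebesgue_measure R).
Local Notation pdf := (normal_pdf 0 sigma).

Lemma normal_pdf0E x :
  pdf x = normal_peak sigma * expR (- x ^+ 2 / (sigma ^+ 2 *+ 2)).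
Proof. by rewrite normal_pdfE// /normal_fun subr0. Qed.

Lemma is_derive_normal_pdf (x : R) : is_derive x 1 pdf (- (x / sigma ^+ 2) * pdf x).
Proof.
have -> : pdf = fun x => normal_peak sigma * expR (- x ^+ 2 / (sigma ^+ 2 *+ 2)).
  by apply/funext => y; exact: normal_pdf0E.
apply: is_derive_eq.
rewrite /GRing.scale/=; field.
by [].
Qed.

(** Doubling the standard deviation absorbs a linear factor: [exp (- x^2 / (2 sigma^2))] is
    [exp (- y) * exp (- x^2 / (8 sigma^2))] with [y = 3 x^2 / (8 sigma^2)], and
    [|x| * exp (- y) <= |sigma|]. The bound gives both integrability and decay at infinity. *)
Lemma normr_mul_normal_pdf_le :
  exists K, forall x, `|x * pdf x| <= K * normal_pdf 0 (2 * sigma) x.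
Proof.
have s2 : 2 * sigma != 0 by rewrite mulf_neq0.
exists (`|sigma| * normal_peak sigma / normal_peak (2 * sigma)) => x.
rewrite normrM (ger0_norm (normal_pdf_ge0 _ _ _)) normal_pdf0E.
rewrite (normal_pdfE _ s2) /normal_fun subr0.
rewrite [leRHS]mulrA divfK ?gt_eqF ?normal_peak_gt0//.
rewrite [`|sigma| * _]mulrC -mulrA mulrCA ler_wpM2l ?normal_peak_ge0//.
pose y := 3 * x ^+ 2 / (sigma ^+ 2 *+ 8).
have -> : - x ^+ 2 / (sigma ^+ 2 *+ 2) = - y + - x ^+ 2 / ((2 * sigma) ^+ 2 *+ 2).
  by rewrite /y; field.
rewrite expRD mulrA ler_wpM2r ?expR_ge0// expRN ler_pdivrMr ?expR_gt0//.
have y1 : 1 + y <= expR y by exact: expR_ge1Dx.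
apply: (@le_trans _ _ (`|sigma| * (1 + y))); last by rewrite ler_wpM2l.
pose u := `|x| / `|sigma|.
have sgt0 : 0 < `|sigma| by rewrite normr_gt0.
have -> : y = 3 / 8 * u ^+ 2.
  rewrite /u expr_div_n !real_normK ?num_real// /y; field.
  by [].
have -> : `|x| = `|sigma| * u by rewrite /u; field; rewrite gt_eqF.
(* The point [4 / 3] is where [1 + 3 / 8 * u ^+ 2 - u] is minimal; its minimum [1 / 3] is
   positive. *)
rewrite ler_pM2l//; have := sqr_ge0 (u - 4 / 3); move: (u) => v.
by rewrite expr2 => ?; lra.
Qed.

Lemma integrable_bounded_mul_normal_pdf (f : R -> R) (M : R) :
  measurable_fun setT f -> (forall x, `|f x| <= M) ->
  mu.-integrable setT (fun x => (f x * pdf x)%:E).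
Proof.
move=> mf fM.
have iM : mu.-integrable setT (fun x => (M%:E * (pdf x)%:E)%E).
  by apply: integrableZl => //; exact: integrable_normal_pdf.
apply: (le_integrable _ _ _ iM) => //.
- apply/measurable_EFinP; apply: measurable_funM => //; exact: measurable_normal_pdf.
- move=> x _; rewrite -EFinM lee_fin !normrM ler_wpM2r//.
  by rewrite (le_trans (fM x))// ler_norm.
Qed.

Lemma integrable_mul_normal_pdf :
  mu.-integrable setT (fun x => (x * pdf x)%:E).
Proof.
have [K Kx] := normr_mul_normal_pdf_le.
have iK : mu.-integrable setT (fun x => (K%:E * (normal_pdf 0 (2 * sigma) x)%:E)%E).
  by apply: integrableZl => //; exact: integrable_normal_pdf.
apply: (le_integrable _ _ _ iK) => //.
- apply/measurable_EFinP; apply: measurable_funM => //; exact: measurable_normal_pdf.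
- by move=> x _; rewrite -EFinM lee_fin (le_trans (Kx x))// ler_norm.
Qed.

End NormalDensity.

Section NormalCosine.
Context {R : realType} (sigma : R) (sigma_neq0 : sigma != 0).
Local Notation mu := (@lebesgue_measure R).
Local Notation pdf := (normal_pdf 0 sigma).

Lemma is_derive_affine (s a y : R) : is_derive y 1 (fun z => s * z + a) s.
Proof. by apply: is_derive_eq; rewrite /GRing.scale/=; ring. Qed.

Lemma integrable_cos_normal_pdf (s a : R) :
  mu.-integrable setT (fun y => (cos (s * y + a) * pdf y)%:E).
Proof.
apply: (@integrable_bounded_mul_normal_pdf _ _ (fun y => cos (s * y + a)) 1);
  last by move=> y; exact: cos_max.
apply: continuous_measurable_fun => y.
have d : derivable (fun z => cos (s * z + a)) y 1.
  exact: ex_derive.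
by apply: differentiable_continuous; exact/derivable1_diffP.
Qed.

Lemma integrable_mul_sin_normal_pdf (s a : R) :
  mu.-integrable setT (fun y => (y * sin (s * y + a) * pdf y)%:E).
Proof.
apply: (le_integrable _ _ _ (integrable_mul_normal_pdf sigma_neq0)) => //.
- apply/measurable_EFinP; apply: measurable_funM => //.
  + apply: measurable_funM => //.
    apply: continuous_measurable_fun => y.
    have d : derivable (fun z => sin (s * z + a)) y 1 by exact: ex_derive.
    by apply: differentiable_continuous; exact/derivable1_diffP.
  + exact: measurable_normal_pdf.
- move=> y _; rewrite lee_fin mulrAC normrM ler_piMr//.
  exact: sin_max.
Qed.

(** Stein's identity [E[Y g(Y)] = sigma^2 E[g'(Y)]] for [g y = sin (s * y + a)]: the derivative of
    [g * pdf] integrates to zero. *)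
Lemma normal_stein_sin (s a : R) :
  \int[mu]_y (y * sin (s * y + a) * pdf y) =
  sigma ^+ 2 * s * \int[mu]_y (cos (s * y + a) * pdf y).
Proof.
pose F y := sin (s * y + a) * pdf y.
pose f y := s * (cos (s * y + a) * pdf y) -
  (sigma ^+ 2)^-1 * (y * sin (s * y + a) * pdf y).
have dF (y : R) : is_derive y 1 F (f y).
  have d1 := is_derive_affine s a y.
  have d2 := is_derive_normal_pdf sigma_neq0 y.
  have d3 : is_derive y 1 (fun y => sin (s * y + a)) (s * cos (s * y + a)).
    by apply: is_derive_eq; rewrite /GRing.scale/=; ring.
  rewrite /F; apply: is_derive_eq; rewrite /f /GRing.scale/=; field.
  exact: sigma_neq0.
have df (y : R) : derivable f y 1.
  have d1 := is_derive_affine s a y.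
  have d2 := is_derive_normal_pdf sigma_neq0 y.
  have d3 : is_derive y 1 (fun y => sin (s * y + a)) (s * cos (s * y + a)).
    by apply: is_derive_eq; rewrite /GRing.scale/=; ring.
  have d4 : is_derive y 1 (fun y => cos (s * y + a)) (- (s * sin (s * y + a))).
    by apply: is_derive_eq; rewrite /GRing.scale/=; ring.
  rewrite /f; exact: ex_derive.
have i1 := integrable_cos_normal_pdf s a.
have i2 := integrable_mul_sin_normal_pdf s a.
have [K Kx] := normr_mul_normal_pdf_le sigma_neq0.
have s2 : 2 * sigma != 0 by rewrite mulf_neq0.
pose C := K * normal_peak (2 * sigma).
have K0 : 0 <= K.
  have := le_trans (normr_ge0 _) (Kx 0).
  rewrite pmulr_lge0// (normal_pdfE _ s2) /normal_fun mulr_gt0//.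
    exact: normal_peak_gt0.
  exact: expR_gt0.
(* A bound on [y * F y] makes the boundary values at [n] and [- n] of order [1 / n]. *)
have FC y : `|y * F y| <= C.
  rewrite /F mulrCA normrM (le_trans (ler_piMl _ (sin_max _)))//.
  by rewrite (le_trans (Kx y))// ler_wpM2l// normal_pdf_ub.
have cvg0 (u : nat -> R) : (forall n, `|u n.+1| <= C / n.+1%:R) ->
    u n @[n --> \oo] --> 0.
  move=> uC; rewrite -cvg_shiftS.
  apply: (@squeeze_cvgr _ _ _ _ (fun n => - (C * n.+1%:R^-1)) (fun n => C * n.+1%:R^-1)).
  - by apply: nearW => n; rewrite -ler_norml uC.
  - rewrite -oppr0 -[X in - X](mulr0 C); apply: cvgN; apply: cvgM; first exact: cvg_cst.
    exact: cvg_harmonic.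
  - rewrite -[X in _ --> X](mulr0 C); apply: cvgM; first exact: cvg_cst.
    exact: cvg_harmonic.
have intf : mu.-integrable setT (fun y => (f y)%:E).
  rewrite /f; under eq_fun do rewrite EFinB !EFinM.
  by apply: integrableB => //; apply: integrableZl.
have := integral_derivative_eq0 dF _ intf.
have -> : (\int[mu]_y (f y)%:E)%E = (\int[mu]_y f y)%:E.
  by rewrite /Rintegral fineK//; exact: integrable_fin_num.
move=> H; have {H} := H _ (cvg0 _ _) (cvg0 _ _).
rewrite /f RintegralB//; last 2 first.
- exact: (integrableZl _ _ i1).
- exact: (integrableZl _ _ i2).
rewrite !RintegralZl// => H; apply/eqP; rewrite -subr_eq0.
set B := \int[mu]_y (cos _ * _) in H *; set A := \int[mu]_y _ in H *.
suff [E] : (s * B - (sigma ^+ 2)^-1 * A)%:E = 0%E.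
  have -> : A - sigma ^+ 2 * s * B = - sigma ^+ 2 * (s * B - (sigma ^+ 2)^-1 * A).
    by field.
  by rewrite E mulr0.
apply: H.
- by move=> y; apply: differentiable_continuous; exact/derivable1_diffP.
- move=> n; have n0 : 0 < n.+1%:R :> R by [].
  rewrite ler_pdivlMr// mulrC -[X in X * _](gtr0_norm n0) -normrM; exact: FC.
- move=> n; have n0 : 0 < n.+1%:R :> R by [].
  rewrite ler_pdivlMr// mulrC -[X in X * _](gtr0_norm n0) -[X in X * _]normrN -normrM.
  exact: FC.
Qed.

(** For [Y] of law [N(0, sigma^2)] this is [E cos (s Y + a)], the real part of [exp (i a)] times the
    characteristic function at [s]. *)
Definition normal_cos (a s : R) := \int[mu]_y (cos (s * y + a) * pdf y).

(** Differentiation under the integral is dominated by [|y * pdf y|]; Stein's identity then turns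
    the derivative into a linear differential equation in [s]. *)
Lemma is_derive_normal_cos (a s : R) :
  is_derive s 1 (normal_cos a) (- (sigma ^+ 2 * s) * normal_cos a s).
Proof.
pose f t y := cos (t * y + a) * pdf y.
have df (t y : R) : is_derive t 1 (f^~ y) (- (y * sin (t * y + a) * pdf y)).
  have d1 : is_derive t 1 (fun z => z * y + a) y.
    by apply: is_derive_eq; rewrite /GRing.scale/=; ring.
  by rewrite /f; apply: is_derive_eq; rewrite /GRing.scale/=; ring.
have pf (t y : R) : partial1of2 f t y = - (y * sin (t * y + a) * pdf y).
  by rewrite partial1of2E derive_val.
have sI : `](s - 1), (s + 1)[%classic s by rewrite /= in_itv/=; lra.
have iG := integrable_abse (integrable_mul_normal_pdf sigma_neq0).
have bnd t y : `](s - 1), (s + 1)[%classic t -> setT y ->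
    `|partial1of2 f t y| <= `|y * pdf y|.
  move=> _ _; rewrite pf normrN mulrAC normrM ler_piMr//; exact: sin_max.
have int_f t : `](s - 1), (s + 1)[%classic t -> mu.-integrable setT (EFin \o f t).
  by move=> _; exact: integrable_cos_normal_pdf.
have der t y : `](s - 1), (s + 1)[%classic t -> setT y -> derivable (f^~ y) t 1.
  by move=> _ _; exact: ex_derive.
have D1 := @derivable_under_integral R _ _ mu f setT measurableT s (s - 1) (s + 1)
  sI int_f der _ (fun=> normr_ge0 _) iG bnd.
have D2 := @differentiation_under_integral R _ _ mu f setT measurableT s (s - 1) (s + 1)
  sI int_f der _ (fun=> normr_ge0 _) iG bnd.
apply: DeriveDef; first exact: D1.
rewrite -derive1E D2.
under eq_Rintegral do rewrite pf.
transitivity (- 1 * \int[mu]_y (y * sin (s * y + a) * pdf y)).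
  rewrite -RintegralZl//; last exact: integrable_mul_sin_normal_pdf.
  by apply: eq_Rintegral => y _; rewrite mulN1r.
by rewrite normal_stein_sin mulN1r mulNr.
Qed.

Lemma Rintegral_cos_normal_pdf (a : R) :
  \int[mu]_y (cos (y + a) * pdf y) = cos a * expR (- (sigma ^+ 2 / 2)).
Proof.
(* The integrating factor of the differential equation: [D] has zero derivative, so its values at 0
   and 1 agree. *)
pose D s := normal_cos a s * expR (sigma ^+ 2 / 2 * s ^+ 2).
have D01 : D 0 = D 1.
  apply: is_derive_0_is_cst => s.
  have d := is_derive_normal_cos a s.
  by rewrite /D; apply: is_derive_eq; rewrite /GRing.scale/=; field.
have D0 : D 0 = cos a.
  rewrite /D expr0n/= mulr0 expR0 mulr1 /normal_cos.
  under eq_Rintegral do rewrite mul0r add0r.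
  rewrite RintegralZl//; last exact: integrable_normal_pdf.
  by rewrite /Rintegral integral_normal_pdf mulr1.
rewrite -D0 D01 /D expr1n mulr1 -mulrA -expRD subrr expR0 mulr1.
by apply: eq_Rintegral => y _; rewrite mul1r.
Qed.

End NormalCosine.

(** * Translations and densities of normal laws *)

Section NormalLaw.
Context {R : realType}.
Local Notation mu := (@lebesgue_measure R).

(** A translation preserves the length of half-open intervals, and these lengths determine the
    Lebesgue measure. *)
Lemma lebesgue_measure_shift (k : R) (A : set R) : measurable A ->
  pushforward mu (fun x : R => (x + k : measurableTypeR R)) A = mu A.
Proof.
move=> mA.
apply/esym/lebesgue_measure_unique => //=; first exact: measurable_funD.
move=> mk _ [[a b] _ <-].
rewrite /pushforward/=.
rewrite [X in _ = mu X](_ : _ = `](a - k), (b - k)]%classic).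
  rewrite !lebesgue_measure_itv/= !lte_fin ltrD2r.
  by rewrite -!EFinB opprB addrA subrK.
by apply/seteqP; split => x /=; rewrite !in_itv/= ltrBlDr lerBrDr.
Qed.

Lemma normal_prob_shift (m k s : R) (B : set R) : s != 0 -> measurable B ->
  normal_prob m s [set x | B (x - k)] = normal_prob (m - k) s B.
Proof.
move=> s0 mB; rewrite /normal_prob.
transitivity (\int[pushforward mu (fun x : R => (x - k)%R : measurableTypeR R)]_(x in B)
    (normal_pdf (m - k) s x)%:E)%E; last first.
  apply: eq_measure_integral => [|mk A mA _]; first exact: measurable_funB.
  exact: lebesgue_measure_shift.
rewrite ge0_integral_pushforward//.
- by apply: eq_integral => x _ /=; rewrite !normal_pdfE// /normal_fun opprB addrA subrK.
- exact: measurable_funB.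
- by apply/measurable_EFinP; apply: measurable_funTS; exact: measurable_normal_pdf.
- by move=> x _; rewrite lee_fin normal_pdf_ge0.
Qed.

Lemma normal_var_shift (m k v : R) (B : set R) : 0 <= v -> measurable B ->
  normal_var m v [set x | B (x - k)] = normal_var (m - k) v B.
Proof.
move=> v0 mB; rewrite /normal_var; case: eqVneq => [_|vn0].
  by rewrite !diracE; congr (_%:R%:E); apply/idP/idP; rewrite !inE.
by rewrite normal_prob_shift// gt_eqF// sqrtr_gt0 lt_neqAle eq_sym vn0.
Qed.

(** The Radon-Nikodym derivative of the normal law agrees almost everywhere with [normal_pdf], since
    both have the same integral over every measurable set. *)
Lemma integral_normal_prob (m s : R) (f : R -> R) :
  (normal_prob m s).-integrable setT (EFin \o f) ->
  \int[normal_prob m s]_x f x = \int[mu]_x (f x * normal_pdf m s x).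
Proof.
move=> intf; rewrite /Rintegral; congr fine.
have dom := @normal_prob_dominates R m s.
rewrite -(Radon_Nikodym_change_of_variables dom measurableT intf).
apply: ae_eq_integral => //.
- apply: emeasurable_funM; first exact: measurable_int intf.
  by apply: (measurable_int mu); exact: Radon_Nikodym_integrable.
- apply/measurable_EFinP; apply: measurable_funM; last exact: measurable_normal_pdf.
  by apply/measurable_EFinP; exact: measurable_int intf.
- under [X in ae_eq _ _ _ X]eq_fun do rewrite EFinM.
  apply: ae_eqe_mul2l; apply: integral_ae_eq => //.
  + exact: Radon_Nikodym_integrable.
  + by apply/measurable_EFinP; exact: measurable_normal_pdf.
  + by move=> E _ mE; rewrite -Radon_Nikodym_integral.
Qed.

End NormalLaw.

Section NormalRandomVariable.
Context d (T : measurableType d) (R : realType) (P : probability T R).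

Lemma integrable_bounded (f : T -> R) (M : R) : measurable_fun setT f ->
  (forall w, `|f w| <= M) -> P.-integrable setT (EFin \o f).
Proof.
move=> mf fM; apply: (@le_integrable _ _ _ P setT measurableT _ (EFin \o cst M)).
- exact/measurable_EFinP.
- by move=> w _; rewrite lee_fin (le_trans (fM w))// ler_norm.
- exact: finite_measure_integrable_cst.
Qed.

Lemma Rintegral_cos_normal_var (L : T -> R) (v a : R) :
  measurable_fun setT L -> 0 <= v ->
  (forall B, measurable B -> P [set w | B (L w)] = normal_var 0 v B) ->
  \int[P]_w cos (L w + a) = cos a * expR (- (v / 2)).
Proof.
move=> mL v0 lawL.
have mc : measurable_fun setT (fun x : R => cos (x + a)).
  apply: measurableT_comp; last exact: measurable_funD.
  by apply: continuous_measurable_fun; exact: continuous_cos.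
have intcL : P.-integrable setT (EFin \o (fun w => cos (L w + a))).
  apply: (@integrable_bounded _ 1); first exact: (measurableT_comp mc mL).
  by move=> w; exact: cos_max.
pose L' : T -> measurableTypeR R := L.
have mL' : measurable_fun setT L' by exact: mL.
have push : (\int[P]_w (cos (L w + a))%:E =
    \int[pushforward P L']_(x in setT) (cos (x + a))%:E)%E.
  rewrite (@integral_pushforward _ _ _ _ _ _ mL' P setT (fun x => (cos (x + a))%:E))//.
  exact/measurable_EFinP.
(* For zero variance the law of [L] is the Dirac mass at 0, and the integral is [cos a]. *)
rewrite /Rintegral push; have [v_eq0|v_neq0] := eqVneq v 0.
  rewrite (@eq_measure_integral _ _ _ _ \d_(0 : measurableTypeR R)).
    rewrite integral_dirac//; last exact/measurable_EFinP.
    by rewrite diracT mul1e/= add0r v_eq0 mul0r oppr0 expR0 mulr1.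
  by move=> A mA _; have := lawL A mA; rewrite /normal_var v_eq0 eqxx => /esym; exact.
have s0 : Num.sqrt v != 0 by rewrite gt_eqF// sqrtr_gt0 lt_neqAle eq_sym v_neq0.
have -> : (\int[pushforward P L']_(x in setT) (cos (x + a))%:E =
    \int[normal_prob 0 (Num.sqrt v)]_(x in setT) (cos (x + a))%:E)%E.
  apply: eq_measure_integral => // A mA _.
  by have := lawL A mA; rewrite /normal_var (negbTE v_neq0); exact.
rewrite -/(Rintegral (normal_prob 0 (Num.sqrt v)) setT (fun x => cos (x + a))).
rewrite integral_normal_prob.
  by rewrite Rintegral_cos_normal_pdf// sqr_sqrtr.
apply: (@le_integrable _ _ _ (normal_prob 0 (Num.sqrt v)) setT measurableT _ (EFin \o cst 1)).
- exact/measurable_EFinP.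
- by move=> w _; rewrite lee_fin normr1 cos_max.
- exact: finite_measure_integrable_cst.
Qed.

End NormalRandomVariable.

(** * Bounded limits of trigonometric polynomials *)

Lemma Bernoulli_inequality (R : realType) (x : R) (n : nat) :
  -1 <= x -> 1 + n%:R * x <= (1 + x) ^+ n.
Proof.
move=> x1; elim: n => [|n IH]; first by rewrite mul0r addr0 expr0.
rewrite exprS (le_trans _ (ler_wpM2l _ IH))//; last by rewrite -lerBlDl sub0r.
rewrite mulrDl mul1r mulrDr mulr1 -natr1 mulrDl mul1r.
have : 0 <= n%:R * x ^+ 2 by rewrite mulr_ge0// sqr_ge0.
by rewrite expr2; lra.
Qed.

(** With [r = q ^+ 2] and [q^-1 = 1 + h], Bernoulli's inequality gives [n * q ^+ n <= h^-1], so the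
    sequence is at most [h^-1 * q ^+ n]. *)
Lemma cvg_natr_mul_expr (R : realType) (r : R) : 0 <= r -> r < 1 ->
  n%:R * r ^+ n @[n --> \oo] --> 0.
Proof.
move=> r0 r1; have [->|rn0] := eqVneq r 0.
  apply: cvg_near_cst; near=> n.
  by rewrite expr0n gt_eqF ?mulr0//; near: n; exact: nbhs_infty_gt.
pose q := Num.sqrt r; pose h := q^-1 - 1.
have rgt0 : 0 < r by rewrite lt_neqAle eq_sym rn0.
have q0 : 0 < q by rewrite sqrtr_gt0.
have q1 : q < 1 by rewrite -sqrtr1 ltr_sqrt.
have h0 : 0 < h by rewrite subr_gt0 invf_gt1.
apply: (@squeeze_cvgr _ _ _ _ (cst 0) (fun n => h^-1 * q ^+ n)).
- apply: nearW => n; rewrite mulr_ge0 ?exprn_ge0//=.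
  rewrite -(sqr_sqrtr r0) -/q -exprM mulnC exprM expr2 mulrA ler_wpM2r ?exprn_ge0 ?(ltW q0)//.
  rewrite -ler_pdivlMr ?exprn_gt0// -exprVn ler_pdivlMl// mulrC.
  have := @Bernoulli_inequality _ h n; rewrite [1 + h]addrC subrK => B.
  have := B (le_trans (lerN10 _) (ltW h0)); apply: le_trans.
  by rewrite lerDr.
- exact: cvg_cst.
- rewrite -[X in _ --> X](mulr0 h^-1); apply: cvgM; first exact: cvg_cst.
  by apply: cvg_expr; rewrite gtr0_norm.
Unshelve. all: by end_near. Qed.

(* The exponent [n * 2 ^ n] makes [1 / 2] the threshold: [u ^ n] times it tends
   to [0] for [u < 1 / 2] and to infinity for [1 / 2 <= u]. *)
Lemma cvg_threshold (R : realType) (u : R) : 0 <= u -> u <= 1 ->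
  1 - (1 - u ^+ n) ^+ (n * 2 ^ n) @[n --> \oo] --> ((2^-1 <= u)%R%:R : R).
Proof.
move=> u0 u1.
have un n : 0 <= 1 - u ^+ n by rewrite subr_ge0 exprn_ile1.
have [ub|ub] := leP 2^-1 u.
- rewrite -[X in _ --> X]subr0; apply: cvgB; first exact: cvg_cst.
  apply: (@squeeze_cvgr _ _ _ _ (cst 0) (fun n => expR (-1) ^+ n)).
  (* Since [1 - u ^+ n <= 1 - 2^-1 ^+ n <= expR (- 2^-1 ^+ n)], the power [2 ^ n] is at most
     [expR (-1)]. *)
  + apply: nearW => n; rewrite exprn_ge0//= mulnC exprM.
    rewrite lerXn2r ?nnegrE ?exprn_ge0 ?expR_ge0//.
    have e : expR (-1 : R) = expR (- (2^-1) ^+ n) ^+ (2 ^ n).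
      rewrite -expRM_natl mulrN natrX -exprMn divff// expr1n.
      by [].
    rewrite e lerXn2r ?nnegrE ?expR_ge0//.
    apply: le_trans (expR_ge1Dx _); rewrite lerD2l lerN2.
    by rewrite lerXn2r// nnegrE.
  + exact: cvg_cst.
  + by apply: cvg_expr; rewrite ger0_norm ?expR_ge0// -[ltRHS]expR0 ltr_expR ltrN10.
- apply: (@squeeze_cvgr _ _ _ _ (cst 0) (fun n => n%:R * (2 * u) ^+ n)).
  + apply: nearW => n /=; rewrite subr_ge0 exprn_ile1//=; last first.
      by rewrite lerBlDr lerDl exprn_ge0.
    rewrite lerBlDl -lerBlDr.
    (* Bernoulli's inequality bounds the expression by [n * 2 ^ n * u ^ n], which tends to 0 when
       [2 * u < 1]. *)
    have := @Bernoulli_inequality _ (- u ^+ n) (n * 2 ^ n).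
    rewrite natrM natrX exprMn mulrN mulrA; apply.
    by rewrite lerN2 exprn_ile1.
  + exact: cvg_cst.
  + by apply: cvg_natr_mul_expr; lra.
Qed.

(** An inductive predicate allows limits to be iterated and properties to be proved by induction.
    The phase [a] supplies sines and constants; the uniform bound [M] makes limits commute with
    expectation. *)
Inductive trig_closure (T : Type) (R : realType) (S : set (T -> R)) :
  (T -> R) -> Prop :=
| trig_closure_cos L a : S L -> trig_closure S (fun w => cos (L w + a))
| trig_closure_lin a f g : trig_closure S f -> trig_closure S g ->
    trig_closure S (fun w => a * f w + g w)
| trig_closure_lim (f_ : nat -> T -> R) (f : T -> R) (M : R) :
    (forall n, trig_closure S (f_ n)) -> (forall n w, `|f_ n w| <= M) ->
    (forall w, f_ n w @[n --> \oo] --> f w) -> trig_closure S f.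

Section TrigClosure.
Context (T : Type) (R : realType) (S : set (T -> R)).
Context (S0 : S (fun=> 0)).
Context (S_lin : forall a L M, S L -> S M -> S (fun w => a * L w + M w)).
Local Notation tc := (trig_closure S).

Lemma trig_closure_bounded f : tc f -> exists M, forall w, `|f w| <= M.
Proof.
elim=> [L a _|a {}f g _ [M fM] _ [N gN]|f_ {}f M _ _ fM fl].
- by exists 1 => w; exact: cos_max.
- exists (`|a| * M + N) => w; rewrite (le_trans (ler_normD _ _))// lerD//.
  by rewrite normrM ler_wpM2l.
- exists M => w; have fn : `|f_ n w| @[n --> \oo] --> `|f w| by apply: cvg_norm; exact: fl.
  rewrite -(cvg_lim _ fn)//; apply: limr_le; first exact: cvgP fn.
  by apply: nearW => n; exact: fM.
Qed.

Lemma trig_closure_eq f g : f =1 g -> tc f -> tc g.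
Proof. by move=> /funext ->. Qed.

Lemma trig_closure_cst c : tc (fun=> c).
Proof.
have z : tc (fun=> 0).
  apply: (trig_closure_eq _ (trig_closure_lin (-1) (trig_closure_cos 0 S0) (trig_closure_cos 0 S0))).
  by move=> w; rewrite mulN1r addrC subrr.
apply: (trig_closure_eq _ (trig_closure_lin c (trig_closure_cos 0 S0) z)).
by move=> w; rewrite add0r cos0 mulr1 addr0.
Qed.

Lemma trig_closureZ c f : tc f -> tc (fun w => c * f w).
Proof.
move=> tf; apply: (trig_closure_eq _ (trig_closure_lin c tf (trig_closure_cst 0))).
by move=> w; rewrite addr0.
Qed.

Lemma trig_closureD f g : tc f -> tc g -> tc (fun w => f w + g w).
Proof.
move=> tf tg; apply: (trig_closure_eq _ (trig_closure_lin 1 tf tg)).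
by move=> w; rewrite mul1r.
Qed.

Lemma trig_closureB f g : tc f -> tc g -> tc (fun w => f w - g w).
Proof.
move=> tf tg; apply: (trig_closure_eq _ (trig_closure_lin (-1) tg tf)).
by move=> w; rewrite mulN1r addrC.
Qed.

(** For a cosine [f], the product-to-sum formula applies because sums and differences of functionals
    stay in [S]; the other cases follow by induction on [f]. *)
Lemma trig_closureM_cos L a f : S L -> tc f -> tc (fun w => f w * cos (L w + a)).
Proof.
move=> SL; elim=> [M b SM|b {}f g _ tf _ tg|f_ {}f M _ tf fM fl].
- have Sp : S (fun w => 1 * M w + L w) by exact: S_lin.
  have Sm : S (fun w => (-1) * L w + M w) by exact: S_lin.
  apply: (trig_closure_eq _ (trig_closureZ 2^-1
    (trig_closureD (trig_closure_cos (b + a) Sp) (trig_closure_cos (b - a) Sm)))) => w.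
  have -> : 1 * M w + L w + (b + a) = (M w + b) + (L w + a) by ring.
  have -> : -1 * L w + M w + (b - a) = (M w + b) - (L w + a) by ring.
  by rewrite cosD cosB; field.
- apply: (trig_closure_eq _ (trig_closure_lin b tf tg)) => w.
  by rewrite mulrDl mulrA.
- apply: (@trig_closure_lim _ _ _ _ _ M tf) => [n w|w].
  + by rewrite normrM (le_trans _ (fM n w))// ler_piMr// cos_max.
  + by apply: cvgM => //; exact: cvg_cst.
Qed.

(** A second induction, now on [g]; the boundedness of [f] keeps the products uniformly bounded in
    the limit case. *)
Lemma trig_closureM f g : tc f -> tc g -> tc (fun w => f w * g w).
Proof.
move=> tf; elim=> [L a SL|a {}g h _ tg _ th|g_ g0 M _ tg gM gl].
- exact: trig_closureM_cos.
- apply: (trig_closure_eq _ (trig_closure_lin a tg th)) => w.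
  by rewrite mulrDr mulrCA.
- have [N fN] := trig_closure_bounded tf.
  apply: (@trig_closure_lim _ _ _ _ _ (N * M) tg) => [n w|w].
  + by rewrite normrM ler_pM.
  + by apply: cvgM => //; exact: cvg_cst.
Qed.

Lemma trig_closureX f n : tc f -> tc (fun w => f w ^+ n).
Proof.
move=> tf; elim: n => [|n IH]; first exact: trig_closure_cst.
by apply: (trig_closure_eq _ (trig_closureM tf IH)) => w; rewrite exprS.
Qed.

Lemma trig_closure_ray L a : S L -> tc (fun w => (a <= L w)%R%:R).
Proof.
move=> SL.
have tsin m : tc (fun w => sin ((L w - a) / m.+1%:R)).
  have Sm : S (fun w => m.+1%:R^-1 * L w + 0) by exact: S_lin.
  apply: (trig_closure_eq _ (trig_closure_cos (- (a / m.+1%:R) - pi / 2) Sm)) => w.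
  rewrite addr0 addrA cosBpihalf.
  have : m.+1%:R != 0 :> R by rewrite pnatr_eq0.
  by move: m.+1%:R => k k0; congr sin; field.
(* This rescales the sine to [[0, 1]], so that its sign becomes the threshold [1 / 2] of
   [cvg_threshold]. *)
pose u m w := (1 + sin ((L w - a) / m.+1%:R)) / 2.
have tu m : tc (u m).
  apply: (trig_closure_eq _ (trig_closureZ 2^-1
    (trig_closureD (trig_closure_cst 1) (tsin m)))) => w.
  by rewrite mulrC.
have u01 m w : 0 <= u m w <= 1.
  have := sin_geN1 ((L w - a) / m.+1%:R); have := sin_le1 ((L w - a) / m.+1%:R).
  by rewrite /u; lra.
have thalf m : tc (fun w => (2^-1 <= u m w)%R%:R).
  apply: (@trig_closure_lim _ _ _
    (fun n w => 1 - (1 - u m w ^+ n) ^+ (n * 2 ^ n)) _ 1) => [n|n w|w].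
  - apply: trig_closureB; first exact: trig_closure_cst.
    apply: trig_closureX; apply: trig_closureB; first exact: trig_closure_cst.
    exact: trig_closureX.
  - have /andP[u0 u1] := u01 m w.
    have v0 : 0 <= 1 - u m w ^+ n by rewrite subr_ge0 exprn_ile1.
    have v1 : 1 - u m w ^+ n <= 1 by rewrite lerBlDr lerDl exprn_ge0.
    rewrite ger0_norm; first by rewrite lerBlDr lerDl exprn_ge0.
    by rewrite subr_ge0 exprn_ile1.
  - by have /andP[u0 u1] := u01 m w; exact: cvg_threshold.
apply: (@trig_closure_lim _ _ _ _ _ 1 thalf) => [m w|w].
  by rewrite ger0_norm ?ler0n// lern1 leq_b1.
(* At each [w] the sequence is eventually constant: once [m.+1] exceeds [|L w - a|], the argument of
   the sine is below 1, hence below [pi], in absolute value, and the sine has its sign. *)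
apply: cvg_near_cst; near=> m.
have Lm : `|L w - a| < m.+1%:R.
  rewrite (lt_le_trans (truncnS_gt _))// ler_nat ltnS.
  by near: m; exists (Num.trunc `|L w - a|).
have pi2 := pi_ge2 R.
have [aL|La] := leP a (L w).
- suff -> : 2^-1 <= u m w by [].
  have : 0 <= sin ((L w - a) / m.+1%:R).
    rewrite ger0_norm ?subr_ge0// in Lm.
    apply: sin_ge0_pi; rewrite divr_ge0 ?subr_ge0//= ler_pdivrMr//.
    by rewrite (le_trans (ltW Lm))// ler_peMl//; lra.
  by rewrite /u; lra.
- suff -> : (2^-1 <= u m w) = false by [].
  apply/negbTE; rewrite -ltNge.
  have : 0 < sin (- ((L w - a) / m.+1%:R)).
    rewrite ltr0_norm ?subr_lt0// in Lm.
    apply: sin_gt0_pi; rewrite -mulNr divr_gt0 ?oppr_gt0 ?subr_lt0//= ltr_pdivrMr//.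
    by rewrite (lt_le_trans Lm)// ler_peMl//; lra.
  by rewrite sinN /u; lra.
Unshelve. all: by end_near. Qed.

(** Complements come from [1 - f] and intersections from products. A countable union is the limit of
    finite unions, whose indicators are eventually constant at each point. *)
Lemma trig_closure_sigma_algebra (T' : Type) (phi : T -> T') :
  sigma_algebra setT [set U : set T' | tc (fun w => \1_U (phi w))].
Proof.
have tC (A : set T') : tc (fun w => \1_A (phi w)) -> tc (fun w => \1_(~` A) (phi w)).
  move=> tA; apply: (trig_closure_eq _ (trig_closureB (trig_closure_cst 1) tA)) => w.
  by rewrite indicC indicE; case: (_ \in _); rewrite ?subrr ?subr0.
have t0 : tc (fun w => \1_(@set0 T') (phi w)).
  by apply: (trig_closure_eq _ (trig_closure_cst 0)) => w; rewrite indic0.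
have tI (A B : set T') : tc (fun w => \1_A (phi w)) -> tc (fun w => \1_B (phi w)) ->
    tc (fun w => \1_(A `&` B) (phi w)).
  move=> tA tB; apply: (trig_closure_eq _ (trig_closureM tA tB)) => w.
  by rewrite indicI.
split => //= [A tA|A tA]; first by rewrite setTD; exact: tC.
have tU N : tc (fun w => \1_(\big[setU/set0]_(n < N) A n) (phi w)).
  elim: N => [|N IH]; first by rewrite big_ord0.
  rewrite big_ord_recr/= -[_ `|` _]setCK setCU.
  exact: (tC _ (tI _ _ (tC _ IH) (tC _ (tA N)))).
apply: (@trig_closure_lim _ _ _ _ _ 1 tU) => [N w|w].
  by rewrite indicE ger0_norm ?ler0n// lern1 leq_b1.
apply: cvg_near_cst.
have [[k _ Ak]|nA] := pselect ((\bigcup_k A k) (phi w)).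
- near=> N; rewrite !indicE !mem_set//; first by exists k.
  rewrite -bigcup_mkord; exists k => //=.
  by near: N; exact: nbhs_infty_gt.
- near=> N; rewrite !indicE !memNset// -bigcup_mkord => -[k _ Ak].
  by apply: nA; exists k.
Unshelve. all: by end_near. Qed.

(** The closed rays unbounded to the right generate the Borel sets. *)
Lemma trig_closure_borel L B : S L -> measurable B -> tc (fun w => \1_B (L w)).
Proof.
move=> SL mB.
have : (@RGenCInfty.G R).-sigma.-measurable B by rewrite -RGenCInfty.measurableE.
apply: (smallest_sub (@trig_closure_sigma_algebra R L)) => _ [a ->] /=.
apply: (trig_closure_eq _ (trig_closure_ray a SL)) => w.
by rewrite indicE mem_setE in_itv/= andbT.
Qed.

End TrigClosure.

(** * Factorization of expectations and independence *)

Section Factorization.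
Context d (T : measurableType d) (R : realType) (P : probability T R).

Lemma cvg_Rintegral_bounded (f_ : nat -> T -> R) (f : T -> R) (M : R) :
  (forall n, measurable_fun setT (f_ n)) -> (forall n w, `|f_ n w| <= M) ->
  (forall w, f_ n w @[n --> \oo] --> f w) ->
  \int[P]_w f_ n w @[n --> \oo] --> \int[P]_w f w.
Proof.
move=> mf fM fl; apply: fine_cvg.
have mlim : measurable_fun setT f by exact: measurable_fun_cvg (fun w _ => fl w).
rewrite fineK; last first.
  apply: integrable_fin_num => //; apply: (@integrable_bounded _ _ _ _ _ M) => // w.
  have fn : `|f_ n w| @[n --> \oo] --> `|f w| by apply: cvg_norm; exact: fl.
  rewrite -(cvg_lim _ fn)//; apply: limr_le; first exact: cvgP fn.
  by apply: nearW => n; exact: fM.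
apply: (@dominated_cvg _ _ _ P setT measurableT (fun n => EFin \o f_ n) (EFin \o f)
  (EFin \o cst M)) => //.
- by move=> n; apply/measurable_EFinP.
- by move=> w _; apply: cvg_EFin; [exact: nearW|exact: fl].
- exact: finite_measure_integrable_cst.
- by move=> n w _; rewrite lee_fin.
Qed.

Lemma trig_closure_measurable (S : set (T -> R)) :
  (forall L, S L -> measurable_fun setT L) ->
  forall f, trig_closure S f -> measurable_fun setT f.
Proof.
move=> mS f; elim=> [L a SL|a {}f g _ mf _ mg|f_ {}f M _ mf _ fl].
- apply: measurableT_comp; last by apply: measurable_funD => //; exact: mS.
  by apply: continuous_measurable_fun; exact: continuous_cos.
- by apply: measurable_funD => //; exact: measurable_funM.
- exact: measurable_fun_cvg (fun w _ => fl w).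
Qed.

(** Both sides are linear in each argument and respect bounded pointwise limits, so two successive
    inductions extend the identity from cosines: first in [g] with a cosine held fixed, then in
    [f]. *)
Lemma trig_closure_factorization (S1 S2 : set (T -> R)) :
  (forall L, S1 L -> measurable_fun setT L) ->
  (forall L, S2 L -> measurable_fun setT L) ->
  (forall L M a b, S1 L -> S2 M ->
    \int[P]_w (cos (L w + a) * cos (M w + b)) =
    \int[P]_w cos (L w + a) * \int[P]_w cos (M w + b)) ->
  forall f g, trig_closure S1 f -> trig_closure S2 g ->
    \int[P]_w (f w * g w) = \int[P]_w f w * \int[P]_w g w.
Proof.
move=> mS1 mS2 factor.
have tc_int S f : (forall L, S L -> measurable_fun setT L) -> trig_closure S f ->
    measurable_fun setT f /\ P.-integrable setT (EFin \o f).
  move=> mS tf; have mf := trig_closure_measurable mS tf; split=> //.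
  by have [M fM] := trig_closure_bounded tf; exact: integrable_bounded fM.
have int_mul f g : trig_closure S1 f -> trig_closure S2 g ->
    P.-integrable setT (EFin \o (fun w => f w * g w)).
  move=> tf tg; have [M fM] := trig_closure_bounded tf.
  have [N gN] := trig_closure_bounded tg.
  apply: (@integrable_bounded _ _ _ _ _ (M * N)).
    by apply: measurable_funM; [exact: (tc_int _ _ mS1 tf).1|exact: (tc_int _ _ mS2 tg).1].
  by move=> w; rewrite normrM ler_pM.
have lin a (f g : T -> R) : P.-integrable setT (EFin \o f) -> P.-integrable setT (EFin \o g) ->
    \int[P]_w (a * f w + g w) = a * \int[P]_w f w + \int[P]_w g w.
  by move=> intf intg; rewrite RintegralD ?RintegralZl//; exact: (integrableZl _ a intf).
have cos_factor L a g : S1 L -> trig_closure S2 g ->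
    \int[P]_w (cos (L w + a) * g w) = \int[P]_w cos (L w + a) * \int[P]_w g w.
  move=> SL; have tL := trig_closure_cos a SL.
  elim=> [M b SM|b {}g h tg IHg th IHh|g_ {}g M tg IH gM gl].
  - exact: factor.
  - rewrite lin; [|exact: (tc_int _ _ mS2 tg).2|exact: (tc_int _ _ mS2 th).2].
    rewrite mulrDr mulrCA -IHg -IHh -lin; [|exact: int_mul|exact: int_mul].
    by apply: eq_Rintegral => w _; rewrite mulrDr mulrCA.
  - have mg n := (tc_int _ _ mS2 (tg n)).1.
    have l1 := cvg_Rintegral_bounded mg gM gl.
    have l2 : \int[P]_w (cos (L w + a) * g_ n w) @[n --> \oo] -->
        \int[P]_w (cos (L w + a) * g w).
      apply: (@cvg_Rintegral_bounded _ _ M) => [n|n w|w].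
      + by apply: measurable_funM => //; exact: (tc_int _ _ mS1 tL).1.
      + by rewrite normrM (le_trans _ (gM n w))// ler_piMl// cos_max.
      + by apply: cvgM; [exact: cvg_cst|exact: gl].
    move: l2; rewrite (eq_cvg _ _ IH) => l2.
    apply: (cvg_unique _ l2); first exact: Rhausdorff.
    by apply: cvgM; [exact: cvg_cst|exact: l1].
move=> f g tf tg; elim: tf => [L a SL|a {}f h tf IHf th IHh|f_ {}f M tf IH fM fl].
- exact: cos_factor.
- rewrite lin; [|exact: (tc_int _ _ mS1 tf).2|exact: (tc_int _ _ mS1 th).2].
  rewrite mulrDl -mulrA -IHf -IHh -lin; [|exact: int_mul|exact: int_mul].
  by apply: eq_Rintegral => w _; rewrite mulrDl mulrA.
- have mf n := (tc_int _ _ mS1 (tf n)).1.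
  have l1 := cvg_Rintegral_bounded mf fM fl.
  have [N gN] := trig_closure_bounded tg.
  have l2 : \int[P]_w (f_ n w * g w) @[n --> \oo] --> \int[P]_w (f w * g w).
    apply: (@cvg_Rintegral_bounded _ _ (M * N)) => [n|n w|w].
    + by apply: measurable_funM => //; exact: (tc_int _ _ mS2 tg).1.
    + by rewrite normrM ler_pM.
    + by apply: cvgM; [exact: fl|exact: cvg_cst].
  move: l2; rewrite (eq_cvg _ _ IH) => l2.
  apply: (cvg_unique _ l2); first exact: Rhausdorff.
  by apply: cvgM; [exact: l1|exact: cvg_cst].
Qed.

End Factorization.

(** * Real linear functionals of complex vectors *)

Section RealLinearFunctionals.
Context (R : realType) (n : nat).
Implicit Types (c x : 'cV[R[i]]_n).

(** Under the identification of [C^n] with [R^(2n)] this is the Euclidean inner product, so every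
    real linear functional has this form. *)
Definition re_dot c x : R := complex.Re ((c^H *m x) 0 0).

Lemma re_dotE c x : re_dot c x =
  \sum_i (complex.Re (c i 0) * complex.Re (x i 0) + complex.Im (c i 0) * complex.Im (x i 0)).
Proof.
rewrite /re_dot mxE raddf_sum; apply: eq_bigr => i _.
rewrite !mxE; case: (c i 0) => a b; case: (x i 0) => a' b'.
by rewrite /= mulNr opprK.
Qed.

Lemma re_dot_linl (a : R) c e x :
  re_dot (a%:C *: c + e) x = a * re_dot c x + re_dot e x.
Proof.
rewrite !re_dotE mulr_sumr -big_split/=; apply: eq_bigr => i _.
rewrite !mxE; case: (c i 0) => a1 b1; case: (e i 0) => a2 b2 /=.
by ring.
Qed.

Lemma re_dot_delta i (z : R[i]) x : re_dot (z *: delta_mx i 0) x =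
  complex.Re z * complex.Re (x i 0) + complex.Im z * complex.Im (x i 0).
Proof.
rewrite re_dotE (bigD1 i)//= big1 ?addr0 => [|j ji].
  by rewrite !mxE !eqxx/= mulr1.
by rewrite !mxE (negbTE ji)/= mulr0 !mul0r addr0.
Qed.

End RealLinearFunctionals.

Section IndependentVectors.
Context d (T : measurableType d) (R : realType) (P : probability T R).

Lemma measurable_re_dot n (X : T -> 'cV[R[i]]_n) c :
  random_cvec X -> measurable_fun setT (fun w => re_dot c (X w)).
Proof.
move=> rX; under eq_fun do rewrite re_dotE.
apply: measurable_sum => i; apply: measurable_funD.
- apply: measurable_funM => // _ B mB; rewrite setTI.
  apply: (rX [set x | B (complex.Re (x i 0))]); apply: sub_sigma_algebra.
  by exists i, B; split=> //; left.
- apply: measurable_funM => // _ B mB; rewrite setTI.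
  apply: (rX [set x | B (complex.Im (x i 0))]); apply: sub_sigma_algebra.
  by exists i, B; split=> //; right.
Qed.

Definition re_functionals n (X : T -> 'cV[R[i]]_n) : set (T -> R) :=
  [set L | exists c, L = fun w => re_dot c (X w)].

(** The coordinate maps that generate [borel_cvec] are real linear functionals, given by the
    multiples 1 and ['i] of basis vectors. *)
Lemma trig_closure_cvec n (X : T -> 'cV[R[i]]_n) U : borel_cvec U ->
  trig_closure (re_functionals X) (fun w => \1_U (X w)).
Proof.
pose S := re_functionals X.
have S0 : S (fun=> 0).
  exists 0; apply/funext => w; rewrite re_dotE big1// => i _.
  by rewrite !mxE/= !mul0r addr0.
have S_lin a L M : S L -> S M -> S (fun w => a * L w + M w).
  move=> [c ->] [e ->]; exists (a%:C *: c + e); apply/funext => w.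
  by rewrite re_dot_linl.
apply: (smallest_sub (trig_closure_sigma_algebra S0 S_lin X)).
move=> _ [i [B [mB [->|->]]]] /=.
- apply: (trig_closure_eq _ (@trig_closure_borel _ _ S S0 S_lin
    (fun w => complex.Re (X w i 0)) B _ mB)) => //.
  exists (1 *: delta_mx i 0); apply/funext => w.
  by rewrite re_dot_delta/= mul1r mul0r addr0.
- apply: (trig_closure_eq _ (@trig_closure_borel _ _ S S0 S_lin
    (fun w => complex.Im (X w i 0)) B _ mB)) => //.
  exists ('i *: delta_mx i 0); apply/funext => w.
  by rewrite re_dot_delta/= mul1r mul0r add0r.
Qed.

(** Factorization of expectations, applied to the indicators of [U] and [V], is the product rule for
    probabilities. *)
Lemma independent_cvec_cos m n (X : T -> 'cV[R[i]]_m) (Y : T -> 'cV[R[i]]_n) :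
  random_cvec X -> random_cvec Y ->
  (forall c e a b,
    \int[P]_w (cos (re_dot c (X w) + a) * cos (re_dot e (Y w) + b)) =
    \int[P]_w cos (re_dot c (X w) + a) * \int[P]_w cos (re_dot e (Y w) + b)) ->
  independent_cvec P X Y.
Proof.
move=> rX rY factor U V bU bV.
have mU : measurable (X @^-1` U) by exact: rX.
have mV : measurable (Y @^-1` V) by exact: rY.
have := @trig_closure_factorization _ _ _ P (re_functionals X) (re_functionals Y)
  _ _ _ _ _ (trig_closure_cvec X bU) (trig_closure_cvec Y bV).
have int_indic (A : set T) : measurable A -> \int[P]_w \1_A w = fine (P A).
  by move=> mA; rewrite /Rintegral integral_indic// setIT.
have -> : (fun w => \1_U (X w) * \1_V (Y w)) = (\1_(X @^-1` U `&` Y @^-1` V) : T -> R).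
  by apply/funext => w; rewrite indicI.
rewrite (int_indic (X @^-1` U)) ?(int_indic (Y @^-1` V)) ?int_indic//; last exact: measurableI.
move=> H.
rewrite -[LHS]fineK ?fin_num_measure//; last exact: measurableI.
rewrite H.
- by rewrite EFinM !fineK ?fin_num_measure.
- by move=> L [c ->]; exact: measurable_re_dot.
- by move=> L [c ->]; exact: measurable_re_dot.
- by move=> L M a b [c ->] [e ->]; exact: factor.
Qed.

End IndependentVectors.

(** * Second moments of complex random vectors *)

Section Adjoint.
Context (R : realType).

Lemma adjmxM m n p (A : 'M[R[i]]_(m, n)) (B : 'M[R[i]]_(n, p)) :
  (A *m B)^H = B^H *m A^H.
Proof. by rewrite /adjmx map_mxM trmx_mul. Qed.

Lemma adjmxD m n (A B : 'M[R[i]]_(m, n)) : (A + B)^H = A^H + B^H.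
Proof. by rewrite /adjmx map_mxD linearD. Qed.

Lemma adjmxN m n (A : 'M[R[i]]_(m, n)) : (- A)^H = - A^H.
Proof. by rewrite /adjmx map_mxN linearN. Qed.

Lemma adjmxK m n (A : 'M[R[i]]_(m, n)) : (A^H)^H = A.
Proof. by apply/matrixP => i j; rewrite !mxE conjcK. Qed.

Lemma adjmx_scale_real m n (s : R) (A : 'M[R[i]]_(m, n)) :
  (s%:C *: A)^H = s%:C *: A^H.
Proof. by apply/matrixP => i j; rewrite !mxE rmorphM/= oppr0. Qed.

Lemma adjmx0 m n : (0 : 'M[R[i]]_(m, n))^H = 0.
Proof. by rewrite /adjmx map_mx0 linear0. Qed.

End Adjoint.

Section Expectation.
Context d (T : measurableType d) (R : realType) (P : probability T R).

Definition cintegrable (Z : T -> R[i]) : Prop :=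
  P.-integrable setT (EFin \o (fun w => complex.Re (Z w))) /\
  P.-integrable setT (EFin \o (fun w => complex.Im (Z w))).

Lemma cexpectE (Z : T -> R[i]) : cexpect P Z =
  (\int[P]_w complex.Re (Z w)) +i* (\int[P]_w complex.Im (Z w)).
Proof. by rewrite /cexpect unlock. Qed.

Lemma integrable_lin (a b : R) (f g : T -> R) :
  P.-integrable setT (EFin \o f) -> P.-integrable setT (EFin \o g) ->
  P.-integrable setT (EFin \o (fun w => a * f w + b * g w)) /\
  \int[P]_w (a * f w + b * g w) = a * \int[P]_w f w + b * \int[P]_w g w.
Proof.
move=> intf intg; have af := integrableZl measurableT a intf.
have bg := integrableZl measurableT b intg; split.
  by have := integrableD measurableT af bg.
by rewrite RintegralD ?RintegralZl.
Qed.

Lemma cintegrableZ a Z : cintegrable Z ->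
  cintegrable (fun w => a * Z w) /\ cexpect P (fun w => a * Z w) = a * cexpect P Z.
Proof.
move=> [intR intI]; case: a => a b.
have ReE w : complex.Re ((a +i* b) * Z w) = a * complex.Re (Z w) + (- b) * complex.Im (Z w).
  by case: (Z w) => x y /=; rewrite mulNr.
have ImE w : complex.Im ((a +i* b) * Z w) = a * complex.Im (Z w) + b * complex.Re (Z w).
  by case: (Z w).
have [i1 e1] := integrable_lin a (- b) intR intI.
have [i2 e2] := integrable_lin a b intI intR.
have eR : (fun w => complex.Re ((a +i* b) * Z w)) = _ := funext ReE.
have eI : (fun w => complex.Im ((a +i* b) * Z w)) = _ := funext ImE.
by rewrite /cintegrable !cexpectE eR eI e1 e2; split=> //=; rewrite mulNr.
Qed.

Lemma cintegrableD Z1 Z2 : cintegrable Z1 -> cintegrable Z2 ->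
  cintegrable (fun w => Z1 w + Z2 w) /\
  cexpect P (fun w => Z1 w + Z2 w) = cexpect P Z1 + cexpect P Z2.
Proof.
move=> [intR1 intI1] [intR2 intI2].
have ReE w : complex.Re (Z1 w + Z2 w) = 1 * complex.Re (Z1 w) + 1 * complex.Re (Z2 w).
  by case: (Z1 w) => x y; case: (Z2 w) => z t /=; rewrite !mul1r.
have ImE w : complex.Im (Z1 w + Z2 w) = 1 * complex.Im (Z1 w) + 1 * complex.Im (Z2 w).
  by case: (Z1 w) => x y; case: (Z2 w) => z t /=; rewrite !mul1r.
have [i1 e1] := integrable_lin 1 1 intR1 intR2.
have [i2 e2] := integrable_lin 1 1 intI1 intI2.
have eR : (fun w => complex.Re (Z1 w + Z2 w)) = _ := funext ReE.
have eI : (fun w => complex.Im (Z1 w + Z2 w)) = _ := funext ImE.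
by rewrite /cintegrable !cexpectE eR eI e1 e2 !mul1r; split.
Qed.

Lemma cintegrable_cst z : cintegrable (fun=> z) /\ cexpect P (fun=> z) = z.
Proof.
split; first by split; exact: finite_measure_integrable_cst.
rewrite cexpectE !Rintegral_cst// (_ : fine (P setT) = 1) ?mulr1; first by case: z.
by rewrite probability_setT.
Qed.

Lemma cintegrable_sum (I : Type) (r : seq I) (F : I -> T -> R[i]) :
  (forall i, cintegrable (F i)) ->
  cintegrable (fun w => \sum_(i <- r) F i w) /\
  cexpect P (fun w => \sum_(i <- r) F i w) = \sum_(i <- r) cexpect P (F i).
Proof.
move=> intF; elim: r => [|i r [IHi IHe]].
  under eq_fun do rewrite big_nil; rewrite big_nil; exact: cintegrable_cst.
under eq_fun do rewrite big_cons; rewrite big_cons -IHe.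
exact: cintegrableD.
Qed.

Definition mxintegrable m n (Z : T -> 'M[R[i]]_(m, n)) : Prop :=
  forall i j, cintegrable (fun w => Z w i j).

Lemma mxexpect_tr m n (Z : T -> 'M[R[i]]_(m, n)) :
  mxexpect P (fun w => (Z w)^T) = (mxexpect P Z)^T.
Proof.
apply/matrixP => i j; rewrite !mxE; congr cexpect.
by apply/funext => w; rewrite mxE.
Qed.

Lemma mxexpect_adj m n (Z : T -> 'M[R[i]]_(m, n)) : mxintegrable Z ->
  mxexpect P (fun w => (Z w)^H) = (mxexpect P Z)^H.
Proof.
move=> intZ; apply/matrixP => i j; rewrite !mxE !cexpectE /=.
have eR : (fun w => complex.Re ((Z w)^H i j)) = (fun w => complex.Re (Z w j i)).
  by apply/funext => w; rewrite !mxE; case: (Z w j i).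
have eI : (fun w => complex.Im ((Z w)^H i j)) = (fun w => -1 * complex.Im (Z w j i)).
  by apply/funext => w; rewrite !mxE mulN1r; case: (Z w j i).
by rewrite eR eI RintegralZl ?mulN1r//; exact: (intZ j i).2.
Qed.

Lemma mxintegrable_tr m n (Z : T -> 'M[R[i]]_(m, n)) : mxintegrable Z ->
  mxintegrable (fun w => (Z w)^T).
Proof. by move=> intZ i j; under eq_fun do rewrite mxE; exact: intZ. Qed.

Lemma mxintegrable_mull m n p (K : 'M[R[i]]_(m, n)) (Z : T -> 'M[R[i]]_(n, p)) :
  mxintegrable Z -> mxintegrable (fun w => K *m Z w) /\
  mxexpect P (fun w => K *m Z w) = K *m mxexpect P Z.
Proof.
move=> intZ; have KZ i j : cintegrable (fun w => (K *m Z w) i j) /\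
    cexpect P (fun w => (K *m Z w) i j) = (K *m mxexpect P Z) i j.
  under eq_fun do rewrite mxE; rewrite mxE.
  have [i1 ->] := cintegrable_sum (index_enum 'I_n)
    (fun k => (cintegrableZ (K i k) (intZ k j)).1).
  split => //; apply: eq_bigr => k _; rewrite mxE.
  exact: (cintegrableZ (K i k) (intZ k j)).2.
split=> [i j|]; first exact: (KZ i j).1.
by apply/matrixP => i j; rewrite mxE (KZ i j).2.
Qed.

(** Transposition reduces this to multiplication on the left. *)
Lemma mxexpect_mulr m n p (Z : T -> 'M[R[i]]_(m, n)) (K : 'M[R[i]]_(n, p)) :
  mxintegrable Z -> mxexpect P (fun w => Z w *m K) = mxexpect P Z *m K.
Proof.
move=> intZ; apply: trmx_inj; rewrite -mxexpect_tr trmx_mul -mxexpect_tr.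
rewrite -(mxintegrable_mull _ (mxintegrable_tr intZ)).2; congr mxexpect.
by apply/funext => w; rewrite trmx_mul.
Qed.

Lemma mxexpectD m n (Z1 Z2 : T -> 'M[R[i]]_(m, n)) : mxintegrable Z1 -> mxintegrable Z2 ->
  mxexpect P (fun w => Z1 w + Z2 w) = mxexpect P Z1 + mxexpect P Z2.
Proof.
move=> int1 int2; apply/matrixP => i j; rewrite !mxE.
by under eq_fun do rewrite mxE; exact: (cintegrableD (int1 i j) (int2 i j)).2.
Qed.

Lemma mxintegrable_cst m n (M : 'M[R[i]]_(m, n)) : mxintegrable (fun=> M).
Proof. by move=> i j; exact: (cintegrable_cst (M i j)).1. Qed.

Lemma mxexpect_cst m n (M : 'M[R[i]]_(m, n)) : mxexpect P (fun=> M) = M.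
Proof. by apply/matrixP => i j; rewrite mxE; exact: (cintegrable_cst (M i j)).2. Qed.

Lemma square_integrable_mxintegrable n (X : T -> 'cV[R[i]]_n) :
  square_integrable P X -> mxintegrable X.
Proof.
move=> X2 i j; rewrite (ord1 j); have [XR XI] := X2 i.
have fin : P setT \is a fin_num by exact: fin_num_measure.
by split; apply/Lfun1_integrable; exact: (Lfun_subset12 fin).
Qed.

Lemma mxexpect_centered n (X : T -> 'cV[R[i]]_n) :
  square_integrable P X -> mxexpect P (centered P X) = 0.
Proof.
move=> /square_integrable_mxintegrable intX.
by rewrite mxexpectD// ?mxexpect_cst ?subrr//; exact: mxintegrable_cst.
Qed.

Lemma centered_mulmx m n (K : 'M[R[i]]_(m, n)) (X : T -> 'cV[R[i]]_n) :
  square_integrable P X ->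
  forall w, centered P (fun w => K *m X w) w = K *m centered P X w.
Proof.
move=> /square_integrable_mxintegrable intX w.
by rewrite /centered (mxintegrable_mull K intX).2 mulmxBr.
Qed.

Lemma square_integrable_centered n (X : T -> 'cV[R[i]]_n) :
  square_integrable P X -> square_integrable P (centered P X).
Proof.
move=> X2 i; have [XR XI] := X2 i.
have cst2 (r : R) : (fun=> r) \in Lfun P 2%:E by exact: Lfun_cst.
split.
- rewrite (_ : (fun _ => _) = (fun w => complex.Re (X w i 0)) -
      (fun=> complex.Re (mxexpect P X i 0))); first by rewrite rpredB ?lee1n.
  by apply/funext => w; rewrite fctE /centered 2!mxE -raddfB.
- rewrite (_ : (fun _ => _) = (fun w => complex.Im (X w i 0)) -
      (fun=> complex.Im (mxexpect P X i 0))); first by rewrite rpredB ?lee1n.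
  by apply/funext => w; rewrite fctE /centered 2!mxE -raddfB.
Qed.

(** Each entry is a combination of products of two [L^2] functions, and such products are in
    [L^1]. *)
Lemma mxintegrable_outer m n (X : T -> 'cV[R[i]]_m) (Y : T -> 'cV[R[i]]_n) :
  square_integrable P X -> square_integrable P Y ->
  mxintegrable (fun w => X w *m (Y w)^H).
Proof.
move=> X2 Y2 i j; have [XR XI] := X2 i; have [YR YI] := Y2 j.
have mul12 (f g : T -> R) : f \in Lfun P 2%:E -> g \in Lfun P 2%:E ->
    P.-integrable setT (EFin \o (fun w => f w * g w)).
  by move=> f2 g2; apply/Lfun1_integrable; exact: Lfun2_mul_Lfun1.
split.
- rewrite (_ : (fun _ => _) = (fun w => 1 * (complex.Re (X w i 0) * complex.Re (Y w j 0)) +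
     1 * (complex.Im (X w i 0) * complex.Im (Y w j 0)))).
    by apply: (integrable_lin _ _ _ _).1; exact: mul12.
  apply/funext => w; rewrite !mxE big_ord1 !mxE !mul1r.
  by case: (X w i 0) => x y; case: (Y w j 0) => z t /=; rewrite mulrN opprK.
- rewrite (_ : (fun _ => _) = (fun w => 1 * (complex.Im (X w i 0) * complex.Re (Y w j 0)) +
     -1 * (complex.Re (X w i 0) * complex.Im (Y w j 0)))).
    by apply: (integrable_lin _ _ _ _).1; exact: mul12.
  apply/funext => w; rewrite !mxE big_ord1 !mxE mul1r mulN1r.
  by case: (X w i 0) => x y; case: (Y w j 0) => z t /=; rewrite mulrN addrC.
Qed.

Lemma crosscov_mulmx m n p (K : 'M[R[i]]_(m, n)) (J : 'M[R[i]]_(p, n)) (Z : T -> 'cV[R[i]]_n) :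
  square_integrable P Z ->
  crosscov P (fun w => K *m Z w) (fun w => J *m Z w) = K *m crosscov P Z Z *m J^H.
Proof.
move=> Z2; have Zc2 := square_integrable_centered Z2.
have intZZ := mxintegrable_outer Zc2 Zc2.
have [intKZ eK] := mxintegrable_mull K intZZ.
rewrite -eK -mxexpect_mulr//; congr mxexpect; apply/funext => w.
by rewrite !centered_mulmx// adjmxM !mulmxA.
Qed.

Lemma crosscov_centered n (Z : T -> 'cV[R[i]]_n) : square_integrable P Z ->
  crosscov P (centered P Z) (centered P Z) = crosscov P Z Z.
Proof.
move=> Z2; congr mxexpect; apply/funext => w.
by rewrite {1 3}/centered mxexpect_centered// subr0.
Qed.

Lemma crosscov_adj n (Z : T -> 'cV[R[i]]_n) : square_integrable P Z ->
  (crosscov P Z Z)^H = crosscov P Z Z.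
Proof.
move=> Z2; have Zc2 := square_integrable_centered Z2.
rewrite -mxexpect_adj; last exact: mxintegrable_outer.
by congr mxexpect; apply/funext => w; rewrite adjmxM adjmxK.
Qed.

Lemma square_integrable_col_mx m n (X : T -> 'cV[R[i]]_m) (Y : T -> 'cV[R[i]]_n) :
  square_integrable P X -> square_integrable P Y ->
  square_integrable P (fun w => col_mx (X w) (Y w)).
Proof.
move=> X2 Y2 i; case: (split_ordP i) => k ->.
- by under eq_fun do rewrite col_mxEu; under [X in _ /\ is_true (X \in _)]eq_fun do rewrite col_mxEu; exact: X2.
- by under eq_fun do rewrite col_mxEd; under [X in _ /\ is_true (X \in _)]eq_fun do rewrite col_mxEd; exact: Y2.
Qed.

End Expectation.

(** * Linear images of Gaussian vectors *)

Section GaussianLinearImages.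
Context d (T : measurableType d) (R : realType) (P : probability T R).

Lemma re_dot_mulmx m n (K : 'M[R[i]]_(m, n)) c x :
  re_dot c (K *m x) = re_dot (K^H *m c) x.
Proof. by rewrite /re_dot adjmxM adjmxK mulmxA. Qed.

Lemma re_dotBr n (c x y : 'cV[R[i]]_n) : re_dot c (x - y) = re_dot c x - re_dot c y.
Proof. by rewrite /re_dot mulmxBr [in LHS]mxE [X in _ + X]mxE; exact: (raddfB (@complex.Re R)). Qed.

(** The functionals include the real and imaginary coordinates, whose preimages generate; this is
    the converse of [measurable_re_dot]. *)
Lemma random_cvec_re_dot n (X : T -> 'cV[R[i]]_n) :
  (forall c, measurable_fun setT (fun w => re_dot c (X w))) -> random_cvec X.
Proof.
move=> mX; apply: smallest_sub.
  split => [|A mA|A mA]; first by rewrite preimage_set0.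
  - by rewrite /= setTD preimage_setC; exact: measurableC.
  - by rewrite /= preimage_bigcup; exact: bigcupT_measurable.
move=> _ [i [B [mB [->|->]]]] /=.
- rewrite (_ : _ @^-1` _ = (fun w => re_dot (1 *: delta_mx i 0) (X w)) @^-1` B).
    by rewrite -[X in measurable X]setTI; exact: mX.
  by apply/seteqP; split=> w /=; rewrite re_dot_delta/= mul1r mul0r addr0.
- rewrite (_ : _ @^-1` _ = (fun w => re_dot ('i *: delta_mx i 0) (X w)) @^-1` B).
    by rewrite -[X in measurable X]setTI; exact: mX.
  by apply/seteqP; split=> w /=; rewrite re_dot_delta/= mul1r mul0r add0r.
Qed.

(** The functional [c] of [K *m (Z - mu)] is the functional [K^H *m c] of [Z] minus a constant, so
    its law is a translate of a known normal law. *)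
Lemma complex_normal_mulmx m n (Z : T -> 'cV[R[i]]_n) mu G (K : 'M[R[i]]_(m, n)) :
  complex_normal P Z mu G ->
  complex_normal P (fun w => K *m (Z w - mu)) 0 (K *m G *m K^H).
Proof.
move=> [rZ G0 lawZ].
have quad (c : 'cV[R[i]]_m) :
    c^H *m (K *m G *m K^H) *m c = (K^H *m c)^H *m G *m (K^H *m c).
  by rewrite adjmxM adjmxK !mulmxA.
split=> [|c|c B mB].
- apply: random_cvec_re_dot => c; under eq_fun do rewrite re_dot_mulmx re_dotBr.
  by apply: measurable_funB => //; exact: measurable_re_dot.
- by rewrite quad.
- have -> : complex.Re ((c^H *m (0 : 'cV[R[i]]_m)) 0 0) = 0 by rewrite mulmx0 mxE.
  rewrite quad.
  have v0 : 0 <= complex.Re (((K^H *m c)^H *m G *m (K^H *m c)) 0 0) / 2.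
    by rewrite divr_ge0//; have := G0 (K^H *m c); rewrite lecE => /andP[].
  (* The mean 0 is written as a difference of equal means, to which the translation rule applies. *)
  rewrite -(subrr (re_dot (K^H *m c) mu)) -normal_var_shift//.
  rewrite -lawZ; last first.
    rewrite (_ : [set _ | _] = (fun x => x - re_dot (K^H *m c) mu) @^-1` B)//.
    rewrite -[X in measurable X]setTI.
    have mk : measurable_fun setT (fun x : R => x - re_dot (K^H *m c) mu).
      exact: measurable_funB.
    exact: mk.
  congr (P _); apply/seteqP; split=> w /=; rewrite -/(re_dot c _) re_dot_mulmx re_dotBr//.
Qed.

(** One factor [1 / 2] comes from the variance in [complex_normal], the other from the exponent
    [- v / 2] of the Fourier transform. *)
Lemma complex_normal0_cos n (Z : T -> 'cV[R[i]]_n) G c a :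
  complex_normal P Z 0 G ->
  \int[P]_w cos (re_dot c (Z w) + a) =
  cos a * expR (- (complex.Re ((c^H *m G *m c) 0 0) / 2 / 2)).
Proof.
move=> [rZ G0 lawZ]; apply: Rintegral_cos_normal_var.
- exact: measurable_re_dot.
- by rewrite divr_ge0//; have := G0 c; rewrite lecE => /andP[].
- have Re0 : complex.Re ((c^H *m (0 : 'cV[R[i]]_n)) 0 0) = 0 by rewrite mulmx0 mxE.
  by move=> B mB; have := lawZ c B mB; rewrite Re0.
Qed.

(** As the cross terms vanish, the sum and the difference of a functional of each image both have
    variance [v1 + v2] up to a common factor, so the product-to-sum formula splits the expectation
    of a product of cosines. *)
Lemma complex_normal_uncorrelated_independent m n p (Z : T -> 'cV[R[i]]_n) mu G
    (K : 'M[R[i]]_(m, n)) (J : 'M[R[i]]_(p, n)) :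
  complex_normal P Z mu G -> K *m G *m J^H = 0 -> J *m G *m K^H = 0 ->
  independent_cvec P (fun w => K *m (Z w - mu)) (fun w => J *m (Z w - mu)).
Proof.
move=> NZ KJ JK.
have NK := complex_normal_mulmx K NZ; have NJ := complex_normal_mulmx J NZ.
apply: independent_cvec_cos; [by case: NK|by case: NJ|move=> c e a b].
rewrite (complex_normal0_cos _ _ NK) (complex_normal0_cos _ _ NJ).
pose v1 := complex.Re ((c^H *m (K *m G *m K^H) *m c) 0 0) / 2 / 2.
pose v2 := complex.Re ((e^H *m (J *m G *m J^H) *m e) 0 0) / 2 / 2.
rewrite -/v1 -/v2.
have NZ0 : complex_normal P (fun w => Z w - mu) 0 G.
  have := complex_normal_mulmx 1%:M NZ.
  have -> : (fun w => 1%:M *m (Z w - mu)) = (fun w => Z w - mu).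
    by apply/funext => w; rewrite mul1mx.
  by rewrite mul1mx (_ : 1%:M^H = 1%:M) ?mulmx1// /adjmx map_mx1 trmx1.
(* The values [s = 1] and [s = -1] treat the sum and the difference at once. *)
have sum_law (s : R) g : s ^+ 2 = 1 ->
    \int[P]_w cos (re_dot (s%:C *: (J^H *m e) + K^H *m c) (Z w - mu) + g) =
    cos g * expR (- (v1 + v2)).
  move=> s2; rewrite (complex_normal0_cos _ _ NZ0); congr (_ * expR (- _)).
  rewrite /v1 /v2 -!mulrDl; congr (_ / 2 / 2); rewrite -raddfD; congr complex.Re.
  set f := s%:C *: _ + _.
  have fH : f^H = s%:C *: (e^H *m J) + c^H *m K.
    by rewrite /f adjmxD adjmx_scale_real !adjmxM !adjmxK.
  rewrite fH /f mulmxDl -scalemxAl mulmxDl mulmxDr mulmxDr -!scalemxAr -!scalemxAl.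
  rewrite !mulmxA.
  have -> : e^H *m J *m G *m K^H = 0 by rewrite -!mulmxA (mulmxA J) JK mulmx0.
  have -> : c^H *m K *m G *m J^H = 0 by rewrite -!mulmxA (mulmxA K) KJ mulmx0.
  rewrite !mul0mx !scaler0 addr0 add0r scalerA -rmorphM/= -expr2 s2 scale1r.
  by rewrite addrC mxE.
pose Wp w := cos (re_dot (1%:C *: (J^H *m e) + K^H *m c) (Z w - mu) + (a + b)).
pose Wm w := cos (re_dot ((-1)%:C *: (J^H *m e) + K^H *m c) (Z w - mu) + (a - b)).
have intW f g : P.-integrable setT (EFin \o (fun w => cos (re_dot f (Z w - mu) + g))).
  apply: (@integrable_bounded _ _ _ _ _ 1); last by move=> w; exact: cos_max.
  apply: measurableT_comp; last first.
    by apply: measurable_funD => //; apply: measurable_re_dot; case: NZ0.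
  by apply: continuous_measurable_fun; exact: continuous_cos.
transitivity (\int[P]_w (2^-1 * Wp w + 2^-1 * Wm w)).
  apply: eq_Rintegral => w _; rewrite /Wp /Wm !re_dot_linl -!re_dot_mulmx.
  set x := re_dot c _; set y := re_dot e _.
  have -> : 1 * y + x + (a + b) = (x + a) + (y + b) by ring.
  have -> : -1 * y + x + (a - b) = (x + a) - (y + b) by ring.
  move: (x + a) (y + b) => {x}x {y}y.
  by rewrite cosD cosB; field.
rewrite (integrable_lin _ _ (intW _ _) (intW _ _)).2.
rewrite !sum_law ?expr1n ?sqrrN ?expr1n//.
by rewrite opprD expRD cosD cosB; field.
Qed.

End GaussianLinearImages.

(** The decomposition and its moments concern square-integrable channels; the Gaussian law of the
    noise and the independence are asserted when the two consecutive channels are jointly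
    Gaussian. *)
Theorem proposition1 (R : realType) (d : measure_display)
    (Omega : measurableType d) (P : probability Omega R)
    (Nr : nat) (h : nat -> Omega -> 'cV[R[i]]_Nr) (t : nat)
    (t_gt0 : (0 < t)%N)
    (h_L2 : forall s : nat, (0 < s)%N -> square_integrable P (h s))
    (Ch_inv : forall s : nat, (0 < s)%N -> crosscov P (h s) (h s) \in unitmx) :
  let C := fun s1 s2 : nat => crosscov P (h s1) (h s2) in
  let A := C t.+1 t *m invmx (C t t) in
  let Theta := C t.+1 t.+1 - C t.+1 t *m invmx (C t t) *m C t t.+1 in
  exists xi : Omega -> 'cV[R[i]]_Nr,
    [/\ forall w, centered P (h t.+1) w = A *m centered P (h t) w + xi w,
        [/\ mxexpect P xi = 0, crosscov P xi xi = Theta &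
            crosscov P (fun w => A *m centered P (h t) w) xi = 0] &
        jointly_complex_normal P (h t) (h t.+1) ->
          complex_normal P xi 0 Theta /\
          independent_cvec P (fun w => A *m centered P (h t) w) xi].
Proof.
move=> C A Theta.
(* The normal equation of linear regression; invertibility of the covariance enters here. Below, [A]
   is used only through this equation and [ThetaE]. *)
have AC : A *m C t t = C t.+1 t by rewrite /A mulmxKV ?Ch_inv.
have ThetaE : Theta = C t.+1 t.+1 - A *m C t t.+1 by [].
clearbody A.
pose Z w := col_mx (h t w) (h t.+1 w).
have Z2 : square_integrable P Z by apply: square_integrable_col_mx; exact: h_L2.
have Zc2 := square_integrable_centered Z2.
pose G := crosscov P Z Z.
(* [E1] and [E2] select the two blocks of [Z], so that every covariance takes the form
   [B1 *m G *m B2^H]. *)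
pose E1 : 'M[R[i]]_(Nr, Nr + Nr) := row_mx 1%:M 0.
pose E2 : 'M[R[i]]_(Nr, Nr + Nr) := row_mx 0 1%:M.
have E1Z : h t = (fun w => E1 *m Z w).
  by apply/funext => w; rewrite mul_row_col mul1mx mul0mx addr0.
have E2Z : h t.+1 = (fun w => E2 *m Z w).
  by apply/funext => w; rewrite mul_row_col mul1mx mul0mx add0r.
have GE : crosscov P Z Z = G by [].
clearbody G E1 E2.
have CE B1 B2 : B1 *m G *m B2^H = crosscov P (fun w => B1 *m Z w) (fun w => B2 *m Z w).
  by rewrite crosscov_mulmx// GE.
have C11 : E1 *m G *m E1^H = C t t by rewrite CE -E1Z.
have C12 : E1 *m G *m E2^H = C t t.+1 by rewrite CE -E1Z -E2Z.
have C21 : E2 *m G *m E1^H = C t.+1 t by rewrite CE -E1Z -E2Z.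
have C22 : E2 *m G *m E2^H = C t.+1 t.+1 by rewrite CE -E2Z.
have cE1 w : centered P (h t) w = E1 *m centered P Z w.
  by rewrite E1Z centered_mulmx.
have cE2 w : centered P (h t.+1) w = E2 *m centered P Z w.
  by rewrite E2Z centered_mulmx.
have GH : G^H = G by rewrite -GE; exact: crosscov_adj.
(* [K] produces the predicted part and [J] the residual. The existentials keep both opaque. *)
have [K KE] : exists K, K = A *m E1 by exists (A *m E1).
have [J JE] : exists J, J = E2 - K by exists (E2 - K).
have KZ : (fun w => A *m centered P (h t) w) = (fun w => K *m centered P Z w).
  by apply/funext => w; rewrite cE1 mulmxA KE.
(* Orthogonality of the residual to the present channel: the left side is
   [C t.+1 t - A *m C t t]. *)
have JGE1 : J *m G *m E1^H = 0.
  by rewrite JE !mulmxBl KE -!mulmxA (mulmxA E1) (mulmxA E2) C11 C21 AC subrr.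
have JGK : J *m G *m K^H = 0 by rewrite KE adjmxM mulmxA JGE1 mul0mx.
have KGJ : K *m G *m J^H = 0.
  have KGJH : (K *m G *m J^H)^H = 0 by rewrite !adjmxM adjmxK GH mulmxA JGK.
  by rewrite -[LHS]adjmxK KGJH adjmx0.
(* Since [J *m G *m K^H = 0], only [J *m G *m E2^H] remains. *)
have JGJ : J *m G *m J^H = Theta.
  rewrite {2}JE adjmxD adjmxN mulmxBr JGK subr0 JE !mulmxBl C22 KE -!mulmxA.
  by rewrite (mulmxA E1) C12 ThetaE.
exists (fun w => J *m centered P Z w); rewrite KZ; split.
- by move=> w; rewrite cE1 cE2 mulmxA -KE -mulmxDl JE addrC subrK.
- split.
  + rewrite (mxintegrable_mull _ (square_integrable_mxintegrable Zc2)).2.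
    by rewrite mxexpect_centered// mulmx0.
  + by rewrite crosscov_mulmx// crosscov_centered// GE.
  + by rewrite crosscov_mulmx// crosscov_centered// GE.
(* [centered P Z w] unfolds to [Z w] minus its mean, so the lemmas on Gaussian images apply with
   [mu] the mean of [Z]. *)
- move=> NZ; rewrite /jointly_complex_normal -/Z GE in NZ.
  split; first by rewrite -JGJ; exact: complex_normal_mulmx NZ.
  exact: complex_normal_uncorrelated_independent NZ KGJ JGK.
Qed.
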